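(* Let $p$ be a prime, $r\ge 1$, $q=p^r$, $m$ a positive integer divisible by $r$, and $n=p^m-1$. Let $C$ be a maximal cyclic code of length $n$ over $\mathbb{F}_q$, with defining set $T$ (a single cyclotomic class). Then the extended code $\hat{C}$ is affine-invariant if and only if $T=Cl(p^j)$ for some $j$ with $0\le j\le m-1$.
   Context: Let $\beta$ be a fixed primitive $n$-th root of unity in $G=\mathbb{F}_{p^m}$, where $n=p^m-1$. A (primitive) cyclic code $C$ of length $n$ over $\mathbb{F}_q$ is an ideal of $\mathbb{F}_q[x]/(x^n-1)$ generated by a polynomial $g(x)$ dividing $x^n-1$; its defining set is $T=\{0\le i\le n-1 : g(\beta^i)=0\}$. It is a union of cyclotomic classes $Cl(j)=\{jq^l \bmod n : l\in\mathbb{Z}\}$. $C$ is called a maximal cyclic code if $T$ consists of exactly one cyclotomic class. The extended code of $C$ is $\hat{C}=\{(x_0,x_1,\dots,x_n) : (x_1,\dots,x_n)\in C,\ x_0=-\sum_{i=1}^n x_i\}$, of length $p^m$. Its coordinates are labelled by the elements of $G$: $x_0$ is labelled by $0\in G$, and the coordinate of $C$ that is the coefficient of $x^i$ ($0\le i\le n-1$) is labelled by $\beta^i$. The set $T$ is also called the defining set of $\hat{C}$. $\hat{C}$ is affine-invariant if it is invariant under all coordinate permutations induced by the maps $X\mapsto aX+b$ of $G$, with $a\in G\setminus\{0\}$, $b\in G$. *)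

(* Defs.v *)
From mathcomp Require Export all_boot all_order all_algebra all_fingroup.
From mathcomp Require Export boolp classical_sets.

Set Implicit Arguments.
Unset Strict Implicit.
Unset Printing Implicit Defensive.

Export GRing.Theory.
Local Open Scope ring_scope.
Local Open Scope classical_set_scope.

(* The exponent l ranges over int.  For l = - k with k > 0, the congruence
   i = j * q ^ l mod n is read as i * q ^ k = j mod n; this is its meaning
   because q is coprime to n in all uses. *)
Definition congr_mul_expz (q n i j : nat) (l : int) : Prop :=
  match l with
  | Posz k => i = j * q ^ k %[mod n]
  | Negz k => i * q ^ k.+1 = j %[mod n]
  end%N.

Definition cyclotomic_class (q n j : nat) : set nat :=
  [set i | (i < n)%N /\ exists l : int, congr_mul_expz q n i j l].

Section CyclicCodes.
Variables (F G : finFieldType) (iota : {rmorphism F -> G}) (n : nat).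

(* For n > 0 the polynomial 'X^n - 1 is monic of size > 1, so that
   {poly %/ 'X^n - 1} is F[x]/(x^n - 1); for n = 0 the library would silently
   quotient by 'X instead. *)
Definition cyclic_ring : nzRingType := {poly %/ ('X^n - 1 : {poly F})}.

Definition ideal_generated_by (g : {poly F}) : set cyclic_ring :=
  [set (u : cyclic_ring) * in_qpoly ('X^n - 1) g | u in setT].

Definition is_cyclic_code_gen (g : {poly F}) (C : set cyclic_ring) : Prop :=
  g %| 'X^n - 1 /\ C = ideal_generated_by g.

Definition defining_set (beta : G) (g : {poly F}) : set nat :=
  [set i | (i < n)%N /\ root (map_poly iota g) (beta ^+ i)].

(* c is identified with the row of its coefficients: entry i is the
   coefficient of x^i. *)
Definition codeword (c : cyclic_ring) : 'rV[F]_n :=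
  poly_rV (c : {poly %/ ('X^n - 1 : {poly F})}).

(* The leftmost coordinate is the overall parity check x_0. *)
Definition extended_code (C : set cyclic_ring) : set 'rV[F]_(1 + n) :=
  [set x | (exists2 c, C c & codeword c = rsubmx x) /\
           x 0 (lshift n 0) = - \sum_(i < n) x 0 (rshift 1 i)].

Definition label (beta : G) (i : 'I_(1 + n)) : G :=
  match split i with
  | inl _ => 0
  | inr k => beta ^+ k
  end.

(* s is the coordinate permutation induced by X |-> a X + b. *)
Definition induced_perm (beta a b : G) (s : 'S_(1 + n)) : Prop :=
  forall i, label beta (s i) = a * label beta i + b.

Definition affine_invariant (beta : G) (D : set 'rV[F]_(1 + n)) : Prop :=
  forall a b : G, a != 0 ->
  forall s : 'S_(1 + n), induced_perm beta a b s ->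
    [set col_perm s x | x in D] = D.

Lemma label_inj (beta : G) : n.-primitive_root beta -> injective (label beta).
Proof.
move=> hb; have n_gt0 := prim_order_gt0 hb.
have nz k : beta ^+ k != 0.
  rewrite expf_neq0 //; apply/eqP => b0; have := prim_expr_order hb.
  by rewrite b0 expr0n gtn_eqF // => /esym/eqP; rewrite oner_eq0.
move=> i j; rewrite /label => ij; rewrite -[i]splitK -[j]splitK; move: ij.
case: (split i) => k; case: (split j) => l.
- by rewrite !ord1.
- by move=> /esym/eqP; rewrite (negPf (nz _)).
- by move=> /eqP; rewrite (negPf (nz _)).
- move=> /eqP; rewrite (eq_prim_root_expr hb) !modn_small // => /eqP kl.
  by congr unsplit; congr inr; apply: val_inj.
Qed.

(* Hence every affine map induces exactly one coordinate permutation, and the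
   quantification over s in [affine_invariant] is not vacuous. *)
Lemma induced_perm_exists_unique (beta a b : G) :
  n.-primitive_root beta -> #|G| = n.+1 -> a != 0 ->
  exists! s : 'S_(1 + n), induced_perm beta a b s.
Proof.
move=> hb cG a0; have linj := label_inj hb.
have [inv lK invK] : bijective (label beta).
  by apply: inj_card_bij linj _; rewrite cG card_ord.
have finj : injective (fun i => inv (a * label beta i + b)).
  by move=> i j /(can_inj invK)/addIr/(mulfI a0)/linj.
exists (perm finj); split=> [i|s hs]; first by rewrite permE invK.
by apply/permP => i; apply: linj; rewrite hs permE invK.
Qed.

End CyclicCodes.

(* Main.v *)
(** For a word x write S_e(x) = sum_i x_i X_i^e, where X_i is the label of
  coordinate i.  Choosing the representative s of T in [1, n], so that 0^s = 0,
  the extended code is {x : S_0(x) = S_s(x) = 0}.  If s = p^j then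
  (aX + b)^s = a^s X^s + b^s, and the code is affine-invariant.  Conversely,
  translation invariance makes the polynomial sum_i x_i (X_i + Y)^s vanish for
  all Y in G.  Writing s = u p^e with p not dividing u, it is a polynomial of
  degree at most u <= n < |G| in Y^(p^e), hence zero; its coefficient of degree
  u - 1 is u S_(p^e)(x), so that p^e lies in T modulo n and T = Cl(p^e). *)
Require Import Defs.
From mathcomp Require Import finfield.

Set Implicit Arguments.
Unset Strict Implicit.
Unset Printing Implicit Defensive.

Local Open Scope ring_scope.
Local Open Scope classical_set_scope.

(** * Cyclotomic classes modulo n *)

Lemma cyclotomic_classP (q n m j i : nat) :
  (0 < m)%N -> q ^ m = 1 %[mod n] ->
  cyclotomic_class q n j i <->
  (i < n)%N /\ exists k : nat, i = j * q ^ k %[mod n].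
Proof.
move=> m_gt0 qm; split=> [[lt_in [[k|k] /= ik]]|[lt_in [k ik]]].
- by split=> //; exists k.
(* As [q ^ m] is 1 modulo n, [q ^ m.-1] is an inverse of q; the exponent -(k+1) is traded for
   (m-1)(k+1). *)
- split=> //; exists (m.-1 * k.+1)%N.
  rewrite -modnMml -ik modnMml -mulnA -expnD -mulSn prednK // expnM.
  by rewrite -modnMmr -modnXm qm modnXm exp1n modnMmr muln1.
- by split=> //; exists k%:Z.
Qed.

(** Multiplication by [q ^ k] is invertible modulo n, so the relation between i and j is symmetric.
    This lets any member of T serve as its representative. *)
Lemma eq_cyclotomic_class (q n m j i k : nat) :
  (0 < m)%N -> q ^ m = 1 %[mod n] -> i = j * q ^ k %[mod n] ->
  cyclotomic_class q n i = cyclotomic_class q n j.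
Proof.
move=> m_gt0 qm ik; have ji : j = i * q ^ (m.-1 * k) %[mod n].
  rewrite -modnMml ik modnMml -mulnA -expnD -mulSn prednK // expnM.
  by rewrite -modnMmr -modnXm qm modnXm exp1n modnMmr muln1.
apply/seteqP; split=> x /(cyclotomic_classP _ _ m_gt0 qm) [lt_xn [l xl]];
    apply/(cyclotomic_classP _ _ m_gt0 qm); split=> //.
  by exists (k + l)%N; rewrite expnD mulnA -modnMml -ik modnMml.
by exists (m.-1 * k + l)%N; rewrite expnD mulnA -modnMml -ji modnMml.
Qed.

Lemma eq_cyclotomic_class_mod (q n i j : nat) :
  i = j %[mod n] -> cyclotomic_class q n i = cyclotomic_class q n j.
Proof.
move=> ij; apply/seteqP; split=> x [lt_xn [[k|k] /= xk]]; split=> //.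
- by exists k%:Z; rewrite /= xk -modnMml ij modnMml.
- by exists (Negz k); rewrite /= xk ij.
- by exists k%:Z; rewrite /= xk -modnMml -ij modnMml.
- by exists (Negz k); rewrite /= xk ij.
Qed.


(** * Vanishing of a translated power sum, in characteristic p *)

Lemma sum_pchar_part_eq0 (G : finFieldType) (I : finType) (c l : I -> G)
    (p s : nat) :
  p \in [pchar G] -> (0 < s < #|G|)%N ->
  (forall b, \sum_i c i * (l i + b) ^+ s = 0) ->
  \sum_i c i * l i ^+ (p ^ logn p s) = 0.
Proof.
move=> pG /andP[s_gt0 lt_sG] sum0; set e := logn p s.
have [u cop_pu s_def] := pfactor_coprime (pcharf_prime pG) s_gt0.
rewrite -/e in s_def.
have P_nat : [pchar G].-nat (p ^ e)%N.
  by rewrite pnatX pnatE ?pG ?(pcharf_prime pG).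
have u_gt0 : (0 < u)%N by case: u s_def s_gt0 {cop_pu} => // ->.
pose L i := l i ^+ (p ^ e).
(* The binomial expansion in Y of the sum of c_i (L_i + Y)^u; by Frobenius, Y = b^(p^e) turns it
   into the sum of c_i (l_i + b)^s. *)
pose f := \poly_(k < u.+1) ((\sum_i c i * L i ^+ (u - k)) *+ 'C(u, k)).
have fE b : f.[b ^+ (p ^ e)] = 0.
  rewrite -[RHS](sum0 b) horner_poly.
  under eq_bigr => k _ do rewrite -sumrMnl mulr_suml.
  rewrite exchange_big; apply: eq_bigr => i _ /=.
  rewrite s_def mulnC exprM exprDn_pchar // exprDn mulr_sumr.
  by apply: eq_bigr => k _; rewrite mulrnAl mulrnAr mulrA.
have Frob_inj : injective (fun b : G => b ^+ (p ^ e)).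
  move=> x y /= xy; apply/eqP; rewrite -subr_eq0.
  have := exprDn_pchar (x - y) y P_nat; rewrite subrK xy => /esym/eqP.
  by rewrite -subr_eq0 addrK expf_eq0 => /andP[].
(* By injectivity of Frobenius f has #|G| distinct roots, while its degree is at most u <= s <
   #|G|. *)
have f0 : f = 0.
  apply: (@roots_geq_poly_eq0 _ _ [seq b ^+ (p ^ e) | b <- enum G]).
  - by apply/allP => _ /mapP[b _ ->]; apply/eqP/fE.
  - by rewrite map_inj_uniq ?enum_uniq.
  rewrite size_map -cardE (leq_trans (size_poly _ _)) // (leq_trans _ lt_sG) //.
  by rewrite ltnS s_def leq_pmulr // expn_gt0 prime_gt0 ?(pcharf_prime pG).
(* The coefficient of degree u - 1 is u times the wanted sum, and u is nonzero in G because p does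
   not divide it. *)
have := coef_poly u.+1
  (fun k => (\sum_i c i * L i ^+ (u - k)) *+ 'C(u, k)) u.-1.
have bin_pred : 'C(u, u.-1) = u by rewrite -{1}(prednK u_gt0) binSn prednK.
have sub_pred : (u - u.-1 = 1)%N by rewrite -{1}(prednK u_gt0) subSnn.
rewrite -/f f0 coef0 ltnS leq_pred bin_pred sub_pred -mulr_natr.
move=> /esym/eqP; rewrite mulf_eq0 -(dvdn_pcharf pG).
rewrite prime_coprime ?(pcharf_prime pG) // in cop_pu.
by rewrite (negPf cop_pu) orbF => /eqP.
Qed.

(** * The extended code described by power sums *)

Section ExtendedCode.
Variables (F G : finFieldType) (iota : {rmorphism F -> G}) (n : nat) (beta : G).
Hypothesis beta_prim : n.-primitive_root beta.

Let n_gt0 : (0 < n)%N := prim_order_gt0 beta_prim.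

Lemma mk_monic_Xn_sub_1 : mk_monic ('X^n - 1 : {poly F}) = 'X^n - 1.
Proof. by rewrite /mk_monic size_Xn_sub_1 // ltnS n_gt0 monicXnsubC. Qed.

Lemma size_cyclic_ring (c : cyclic_ring F n) : (size (polyn c) <= n)%N.
Proof.
rewrite -ltnS (leq_trans (size_mk_monic c)) //.
by rewrite mk_monic_Xn_sub_1 size_Xn_sub_1.
Qed.

(** Since g divides X^n - 1, reduction modulo X^n - 1 preserves divisibility by g. *)
Lemma ideal_generated_byE (g : {poly F}) (c : cyclic_ring F n) :
  g %| 'X^n - 1 -> ideal_generated_by g c <-> g %| polyn c.
Proof.
move=> g_dvd.
have dvd_in h : g %| polyn (in_qpoly ('X^n - 1) h) = (g %| h).
  rewrite /= mk_monic_Xn_sub_1 -Pdiv.IdomainMonic.modpE ?monicXnsubC //.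
  by rewrite -dvdp_mod.
have in_polyn (h : cyclic_ring F n) : in_qpoly ('X^n - 1) (polyn h) = h.
  exact/val_inj/in_qpoly_small/size_mk_monic.
split=> [[u _ <-]|/dvdpP[u cE]].
  by rewrite -[u]in_polyn -in_qpolyM dvd_in dvdp_mull.
by exists (in_qpoly _ u) => //; rewrite -in_qpolyM -cE in_polyn.
Qed.

(** Over G, X^n - 1 is the product of the distinct factors X - beta^i, so g is up to a unit a
    product of some of them, and divisibility by g can be tested on roots. *)
Lemma dvdp_map_roots (g c : {poly F}) :
  g %| 'X^n - 1 ->
  g %| c <-> (forall i, defining_set iota n beta g i ->
                root (map_poly iota c) (beta ^+ i)).
Proof.
move=> g_dvd; split=> [g_c i [_]|roots_c].
  by apply: root_dvdp; rewrite dvdp_map.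
have gG_dvd : map_poly iota g %| \prod_(0 <= i < n) ('X - (beta ^+ i)%:P).
  rewrite factor_Xn_sub_1 // -(rmorph1 (map_poly iota)) -(map_polyXn iota).
  by rewrite -rmorphB dvdp_map.
have [m gGE] := dvdp_prod_XsubC gG_dvd.
rewrite -(dvdp_map iota) (eqp_dvdl _ gGE) -(big_map (fun i => beta ^+ i) xpredT
  (fun z => 'X - z%:P)); apply: uniq_roots_dvdp.
  apply/allP => _ /mapP[i im ->]; apply: roots_c; split.
    by have /mem_mask := im; rewrite mem_index_iota.
  by rewrite (eqp_root gGE) -(big_map (fun i => beta ^+ i) xpredT
    (fun z => 'X - z%:P)) root_prod_XsubC map_f.
rewrite uniq_rootsE map_inj_in_uniq ?mask_uniq ?iota_uniq // => i j.
move=> /mem_mask + /mem_mask; rewrite !mem_index_iota /= => lt_in lt_jn.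
by move/eqP; rewrite (eq_prim_root_expr beta_prim) !modn_small // => /eqP.
Qed.

(** The power map of exponent #|F| is a ring endomorphism of G fixing the image of F. Hence a root
    at beta^s propagates to the whole class of s. *)
Lemma horner_map_Xcard (c : {poly F}) (y : G) : [pchar G].-nat #|F| ->
  (map_poly iota c).[y ^+ #|F|] = (map_poly iota c).[y] ^+ #|F|.
Proof.
move=> F_nat; elim/poly_ind: c => [|c a IHc].
  by rewrite rmorph0 !horner0 expr0n gtn_eqF // (ltnW (finNzRing_gt1 F)).
rewrite rmorphD rmorphM /= map_polyX map_polyC !hornerMXaddC.
by rewrite exprDn_pchar // exprMn IHc -rmorphXn expf_card.
Qed.

(** The sum S_e. Since [0 ^+ 0 = 1], the coordinate labelled 0 counts for e = 0 only, which makes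
    S_0 the parity check. *)
Definition power_sum (x : 'rV[F]_(1 + n)) (e : nat) : G :=
  \sum_i iota (x 0 i) * label beta i ^+ e.

Lemma power_sum0 x : power_sum x 0 = iota (\sum_i x 0 i).
Proof. by rewrite rmorph_sum; apply: eq_bigr => i _; rewrite mulr1. Qed.

Lemma label_rshift (k : 'I_n) : label beta (rshift 1 k) = beta ^+ k.
Proof. by rewrite /label (unsplitK (inr k)). Qed.

Lemma label_lshift (k : 'I_1) : label beta (lshift n k) = 0.
Proof. by rewrite /label (unsplitK (inl k)). Qed.

Lemma power_sum_horner x e : (0 < e)%N ->
  power_sum x e = (map_poly iota (rVpoly (rsubmx x))).[beta ^+ e].
Proof.
move=> e_gt0; rewrite (@horner_coef_wide _ n); last first.
  by rewrite size_map_poly size_poly.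
rewrite /power_sum big_split_ord /= big_ord1 label_lshift expr0n gtn_eqF //.
rewrite mulr0 add0r; apply: eq_bigr => k _.
by rewrite label_rshift coef_map coef_rVpoly_ord mxE -!exprM mulnC.
Qed.

(** S_0 is the parity check and S_s the value of the codeword at beta^s, which decides all roots in
    the class of s. Here s is positive but not reduced modulo n, so that s = n can stand for the
    class of 0. *)
Lemma extended_codeP (g : {poly F}) (C : set (cyclic_ring F n)) (s : nat)
    (x : 'rV[F]_(1 + n)) :
  [pchar G].-nat #|F| -> is_cyclic_code_gen g C -> (0 < s)%N ->
  (forall i, defining_set iota n beta g i ->
     exists k, i = s * #|F| ^ k %[mod n])%N ->
  defining_set iota n beta g (s %% n)%N ->
  extended_code C x <-> power_sum x 0 = 0 /\ power_sum x s = 0.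
Proof.
move=> F_nat [g_dvd ->] s_gt0 T_sub T_s.
have parity : x 0 (lshift n 0) = - \sum_(i < n) x 0 (rshift 1 i) <->
    power_sum x 0 = 0.
  rewrite power_sum0 big_split_ord /= big_ord1.
  split=> [->|/eqP]; first by rewrite addNr rmorph0.
  by rewrite fmorph_eq0 addr_eq0 => /eqP.
have member (c : {poly F}) :
    g %| c <-> root (map_poly iota c) (beta ^+ s).
  rewrite (dvdp_map_roots _ g_dvd); split=> [/(_ _ T_s)|rs i /T_sub[k]].
    by rewrite prim_expr_mod.
  rewrite -(prim_expr_mod beta_prim i) => ->; rewrite prim_expr_mod //.
  elim: k => [|k IHk]; first by rewrite muln1.
  rewrite expnSr mulnA exprM rootE horner_map_Xcard // expf_eq0 -rootE IHk.
  rewrite andbT; exact/ltnW/finNzRing_gt1.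
rewrite (power_sum_horner _ s_gt0); split=> [[[c Cc cx] x0]|[x0 xs]].
  split; first exact/parity.
  rewrite -cx /codeword poly_rV_K ?size_cyclic_ring //.
  by apply/eqP/member/ideal_generated_byE.
split; last exact/parity.
have sz : (size (rVpoly (rsubmx x)) < size (mk_monic ('X^n - 1 : {poly F})))%N.
  by rewrite mk_monic_Xn_sub_1 size_Xn_sub_1 // ltnS size_poly.
exists (in_qpoly _ (rVpoly (rsubmx x))).
  apply/ideal_generated_byE => //.
  by rewrite in_qpoly_small //; apply/member/eqP.
by rewrite /codeword in_qpoly_small // rVpolyK.
Qed.

(** The extension of the codeword of g itself is the test word: g and its residue modulo X^n - 1
    agree at beta^e. *)
Lemma defining_set_mod (g : {poly F}) (C : set (cyclic_ring F n)) (e : nat) :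
  is_cyclic_code_gen g C -> (0 < e)%N ->
  (forall x, extended_code C x -> power_sum x e = 0) ->
  defining_set iota n beta g (e %% n)%N.
Proof.
move=> [_ ->] e_gt0 vanish; split; first by rewrite ltn_mod.
rewrite prim_expr_mod //; set c := in_qpoly ('X^n - 1) g.
pose x : 'rV[F]_(1 + n) :=
  row_mx (const_mx (- \sum_i codeword c 0 i)) (codeword c).
have /vanish : extended_code (ideal_generated_by g) x.
  split; first by exists c; rewrite ?row_mxKr //; exists 1; rewrite ?mul1r.
  rewrite row_mxEl mxE; congr (- _).
  by apply: eq_bigr => i _; rewrite row_mxEr.
rewrite power_sum_horner // row_mxKr poly_rV_K ?size_cyclic_ring //.
rewrite /= mk_monic_Xn_sub_1 -Pdiv.IdomainMonic.modpE ?monicXnsubC // => r0.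
rewrite (divp_eq g ('X^n - 1)) rootE rmorphD rmorphM rmorphB /= map_polyXn.
rewrite rmorph1 !hornerE r0 -exprM mulnC exprM (prim_expr_order beta_prim).
by rewrite expr1n subrr mulr0 addr0.
Qed.

(** * Action of the affine permutations *)

Lemma power_sum_col_perm (a b : G) (s : 'S_(1 + n)) x e :
  a != 0 -> induced_perm beta a b s ->
  power_sum (col_perm s x) e =
  \sum_i iota (x 0 i) * (a^-1 * (label beta i - b)) ^+ e.
Proof.
(* [col_perm s x] has entry [x 0 (s i)] at i, so the inverse affine map acts on the labels. *)
move=> a0 hs; rewrite [RHS](reindex_inj (@perm_inj _ s)); apply: eq_bigr => i _.
by rewrite mxE hs addrK mulKf.
Qed.

Lemma induced_permV (a b : G) (s : 'S_(1 + n)) :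
  a != 0 -> induced_perm beta a b s ->
  induced_perm beta a^-1 (- (a^-1 * b)) s^-1.
Proof.
by move=> a0 hs i; rewrite -{2}(permKV s i) hs mulrDr mulKf // addrK.
Qed.

(** One inclusion suffices, because the inverse permutation is again induced by an affine map. *)
Lemma affine_invariant_sub (D : set 'rV[F]_(1 + n)) :
  (forall (a b : G) (s : 'S_(1 + n)) x, a != 0 -> induced_perm beta a b s ->
     D x -> D (col_perm s x)) ->
  affine_invariant beta D.
Proof.
move=> D_stable a b a0 s hs; apply/seteqP; split=> [_ [x Dx <-]|x Dx].
  exact: D_stable hs Dx.
exists (col_perm s^-1 x); last by rewrite -col_permM mulgV col_perm1.
by apply: D_stable (induced_permV a0 hs) Dx; rewrite invr_eq0.
Qed.

End ExtendedCode.

(** * Affine invariance of extended maximal cyclic codes *)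

Theorem proposition2 (p r q m n : nat) (F G : finFieldType)
    (iota : {rmorphism F -> G}) (beta : G)
    (g : {poly F}) (C : set (cyclic_ring F n)) (T : set nat)
    (hp : prime p) (hr : (1 <= r)%N) (hq : q = (p ^ r)%N)
    (hm : (0 < m)%N) (hrm : (r %| m)%N) (hn : n = (p ^ m - 1)%N)
    (hF : #|F| = q) (hG : #|G| = (p ^ m)%N)
    (hbeta : n.-primitive_root beta)
    (hC : is_cyclic_code_gen g C)
    (hT : T = defining_set iota n beta g)
    (hmax : exists s : nat, T = cyclotomic_class q n s) :
  affine_invariant beta (extended_code C) <->
  exists j : nat, (0 <= j <= m - 1)%N /\ T = cyclotomic_class q n (p ^ j)%N.
Proof.
have n_gt0 := prim_order_gt0 hbeta.
have nS : n.+1 = (p ^ m)%N by rewrite hn subn1 prednK // expn_gt0 prime_gt0.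
have pG : p \in [pchar G] := card_finPcharP hG hp.
have P_nat e : [pchar G].-nat (p ^ e)%N by rewrite pnatX pnatE ?pG.
have F_nat : [pchar G].-nat #|F| by rewrite hF hq.
have qm : q ^ m = 1 %[mod n].
  by rewrite hq -expnM mulnC expnM -nS -modnXm -addn1 modnDl modnXm exp1n.
have codeP s x : (0 < s)%N -> T = cyclotomic_class q n s ->
    extended_code C x <->
    power_sum iota beta x 0 = 0 /\ power_sum iota beta x s = 0.
  move=> s_gt0 Ts; apply: (extended_codeP hbeta x F_nat hC s_gt0).
    by move=> i; rewrite -hT Ts hF => /(cyclotomic_classP _ _ hm qm)[].
  rewrite -hT Ts; apply/(cyclotomic_classP _ _ hm qm); rewrite ltn_mod.
  by split=> //; exists 0%N; rewrite muln1 modn_mod.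
split=> [C_inv|[j [/andP[_ le_jm] Tj]]]; last first.
  have pj_gt0 : (0 < p ^ j)%N by rewrite expn_gt0 prime_gt0.
  apply: affine_invariant_sub => a b s x a0 hs /(codeP _ _ pj_gt0 Tj)[x0 xj].
  apply/(codeP _ _ pj_gt0 Tj); rewrite !(power_sum_col_perm _ _ _ a0 hs); split.
    by rewrite -[RHS]x0; apply: eq_bigr => i _; rewrite !expr0.
  (* By additivity of Frobenius, the permuted S_(p^j) is a linear combination of S_(p^j) and S_0. *)
  transitivity (a^-1 ^+ (p ^ j) * (power_sum iota beta x (p ^ j) +
      (- b) ^+ (p ^ j) * power_sum iota beta x 0)); last first.
    by rewrite x0 xj mulr0 addr0 mulr0.
  rewrite mulr_sumr -big_split mulr_sumr; apply: eq_bigr => i _ /=.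
  by rewrite exprMn exprDn_pchar // expr0 mulr1 [_ * iota _]mulrC -mulrDr
    mulrCA.
have [s0 Ts0] := hmax.
(* The class Cl(0) is represented by s = n rather than 0, because 0 ^ 0 = 1. *)
have [s s_gt0 [le_sn Ts]] : exists2 s, (0 < s)%N &
    (s <= n)%N /\ T = cyclotomic_class q n s.
  have [s0_0|s0_gt0] := posnP (s0 %% n).
    exists n => //; split=> //; rewrite Ts0; apply: eq_cyclotomic_class_mod.
    by rewrite s0_0 modnn.
  exists (s0 %% n)%N => //; split; first by rewrite ltnW ?ltn_mod.
  by rewrite Ts0; apply: eq_cyclotomic_class_mod; rewrite modn_mod.
set e := logn p s; have pe_gt0 : (0 < p ^ e)%N by rewrite expn_gt0 prime_gt0.
have le_pes : (p ^ e <= s)%N by rewrite dvdn_leq // pfactor_dvdnn.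
have pe_sum0 x : extended_code C x -> power_sum iota beta x (p ^ e) = 0.
  move=> Cx; apply: (sum_pchar_part_eq0 pG); first by rewrite s_gt0 hG -nS.
  move=> b.
  (* Translation by -b is taken because the power sums see its inverse X + b. *)
  have [sg [hsg _]] := induced_perm_exists_unique (- b) hbeta
    (etrans hG (esym nS)) (oner_neq0 G).
  have : extended_code C (col_perm sg x).
    by rewrite -(C_inv _ _ (oner_neq0 G) _ hsg); exists x.
  move=> /(codeP _ _ s_gt0 Ts)[_].
  rewrite (power_sum_col_perm _ _ _ _ hsg) ?oner_eq0 //.
  by under eq_bigr => i _ do rewrite invr1 mul1r opprK.
(* As p^e <= s <= n and p does not divide n, the reduction changes p^e only when n = 1. *)
have T_pe : T (p ^ e %% n)%N by rewrite hT; apply: defining_set_mod pe_sum0.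
exists e; split.
  (* The bound e < m follows from p^e <= s <= n < p^m. *)
  rewrite leq0n -[(e <= _)%N]ltnS subn1 prednK //=.
  rewrite -(ltn_exp2l _ _ (prime_gt1 hp)) -nS ltnS.
  exact: leq_trans le_sn.
move: T_pe; rewrite Ts => /(cyclotomic_classP _ _ hm qm)[_ [k]].
by rewrite modn_mod => /(eq_cyclotomic_class hm qm).
Qed.
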